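(* Let $p$ and $q$ be two odd prime numbers with $p < q$. Then the Sombor index of the total graph $T_\Gamma(\mathbb{Z}_{p^2q})$ is $$SO(T_\Gamma(\mathbb{Z}_{p^2q})) = \sqrt{2}\,\alpha\,(p^2q-\phi(p^2q)-1) + \beta\sqrt{(p^2q-\phi(p^2q)-1)^2+(p^2q-\phi(p^2q))^2} + \sqrt{2}\,(|E|-\alpha-\beta)(p^2q-\phi(p^2q)),$$ where $$\alpha = \frac{p(q-1)(p(q-1)-1)}{2}+ \frac{p(p-1)(p(p-1)-1)}{2}+\frac{p(p-1)}{2} +p^2(q-1)+p^2(p-1),$$ $$\beta = 2p^2(p-1)(q-1),\qquad |E| = \frac{p(p+q-1)(p^2q-1)}{2}.$$
   Context: For a finite simple graph $G$, the Sombor index is $SO(G)=\sum_{uv\in E(G)}\sqrt{d_u^2+d_v^2}$, the sum being over (unordered) edges, where $d_x$ is the degree of the vertex $x$. For a commutative ring $R$ with unity, $Z(R)$ denotes the set of zero-divisors of $R$, including $0$. The total graph $T_\Gamma(R)$ is the simple graph whose vertices are all elements of $R$, with distinct vertices $x,y$ adjacent if and only if $x+y\in Z(R)$. $\mathbb{Z}_n$ is the ring of integers modulo $n$ and $\phi$ is Euler's totient function. *)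

(* Defs.v *)
From HB Require Import structures.
From mathcomp Require Import all_boot all_order all_algebra.
From mathcomp Require Import reals.

Set Implicit Arguments.
Unset Strict Implicit.
Unset Printing Implicit Defensive.

Import Order.TTheory GRing.Theory Num.Theory.
Local Open Scope ring_scope.

Record sgraph := SGraph {
  vertex :> finType;
  adj : rel vertex;
  adj_sym : symmetric adj;
  adj_irrefl : irreflexive adj
}.

Definition edges (G : sgraph) : {set {set G}} :=
  [set [set x; y] | x in G, y in adj x].

Definition degree (G : sgraph) (x : G) : nat := #|adj x|.

(* For an edge e = [set u; v] one has u != v, so the sum under the root is
   (degree u)^2 + (degree v)^2; the outer sum counts each unordered edge once. *)
Definition Sombor (R : realType) (G : sgraph) : R :=
  \sum_(e in edges G) Num.sqrt (\sum_(x in e) (degree x)%:R ^+ 2).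

(* 0 is a zero-divisor in this sense, because 0 * 1 = 0 and 1 != 0. *)
Definition zero_divisor (A : finComNzRingType) (x : A) : bool :=
  [exists y : A, (y != 0) && (x * y == 0)].

Section TotalGraph.
Variable A : finComNzRingType.

Definition total_adj : rel A :=
  fun x y => (x != y) && zero_divisor (x + y).

Lemma total_adj_sym : symmetric total_adj.
Proof. by move=> x y; rewrite /total_adj eq_sym addrC. Qed.

Lemma total_adj_irrefl : irreflexive total_adj.
Proof. by move=> x; rewrite /total_adj eqxx. Qed.

Definition total_graph : sgraph := SGraph total_adj_sym total_adj_irrefl.

End TotalGraph.

(* Main.v *)
(* When 2 is invertible, the degree of x in the total graph is z - 1 or z, where
   z is the number of zero-divisors, according as x is a zero-divisor or not.
   So the Sombor index is determined by z and by the number b of pairs (x, y)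
   with x and x + y zero-divisors and y not.  Replacing (x, y) by (- x, x + y),
   b counts the pairs of zero-divisors whose sum is not a zero-divisor; in
   Z/p^2q these are the pairs with one element divisible by p only and the
   other by q only.  Hence b = beta and z (z - 1) - b = 2 alpha. *)
Require Import Defs.
From HB Require Import structures.
From mathcomp Require Import all_boot all_order all_algebra.
From mathcomp Require Import reals.
From mathcomp Require Import ring zify.

Set Implicit Arguments.
Unset Strict Implicit.
Unset Printing Implicit Defensive.

Import Order.TTheory GRing.Theory Num.Theory.
Local Open Scope ring_scope.

(** * Sums over edges as sums over ordered adjacent pairs *)

Lemma sum_adj_edges (V : nmodType) (G : sgraph) (F : {set G} -> V) :
  \sum_(x : G) \sum_(y | adj x y) F [set x; y] = (\sum_(e in edges G) F e) *+ 2.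
Proof.
rewrite pair_big_dep /=.
rewrite (partition_big (fun u => [set u.1; u.2]) (mem (edges G))) /=; last first.
  by move=> [x y] /= xy; apply/imset2P; exists x y.
rewrite -sumrMnl; apply: eq_bigr => _ /imset2P[a b _ ab ->].
have {}ab : adj a b := ab.
have neq_ab : a != b by apply: contraTneq ab => ->; rewrite adj_irrefl.
(* The fibre over an edge consists of its two orientations, which differ because [adj] is
   irreflexive. *)
transitivity (\sum_(u in [set (a, b); (b, a)]) F [set a; b]).
  apply: eq_big => [[x y]|[x y] /andP[_ /eqP->] //]; rewrite !inE /= !xpair_eqE.
  apply/andP/idP => [[xy /eqP eq_xyab]|].
    have neq_xy : x != y by apply: contraTneq xy => ->; rewrite adj_irrefl.
    move: neq_xy (set21 x y) (set22 x y); rewrite eq_xyab !inE => neq_xy.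
    by case/orP=> /eqP x_eq /orP[] /eqP y_eq; move: neq_xy;
      rewrite x_eq y_eq !eqxx ?orbT.
  by case/orP=> /andP[/eqP-> /eqP->]; [|rewrite adj_sym setUC].
by rewrite sumr_const cards2 xpair_eqE negb_and neq_ab.
Qed.

(** * Zero-divisors of a finite commutative ring *)

Section ZeroDivisors.
Variable A : finComNzRingType.
Implicit Types x y u : A.
Local Notation zd := (@zero_divisor A).

Lemma zero_divisorN x : zd (- x) = zd x.
Proof. by apply: eq_existsb => y; rewrite mulNr oppr_eq0. Qed.

(** Since 2 is a unit with inverse [y], the elements [x + x] and [x] have the same annihilator. *)
Lemma zero_divisor_double x y : 2%:R * y = 1 :> A -> zd (x + x) = zd x.
Proof.
move=> y2; apply: eq_existsb => z; congr (_ && _).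
rewrite -mulr2n -mulr_natl -mulrA.
apply/eqP/eqP => [xz0|->]; last by rewrite mulr0.
by rewrite -[_ * _]mul1r -y2 (mulrC 2%:R) -mulrA xz0 mulr0.
Qed.

End ZeroDivisors.

Definition zd_nb (A : finComNzRingType) : nat := #|[set x : A | zero_divisor x]|.

(** Non-zero-divisors of a finite ring are units, hence the name. Pairs are ordered. *)
Definition zd_unit_sum_nb (A : finComNzRingType) : nat :=
  #|[set u : A * A | [&& zero_divisor u.1, zero_divisor u.2
                        & ~~ zero_divisor (u.1 + u.2)]]|.

(** * Degrees, edges and Sombor index of a total graph when 2 is invertible *)

Section TotalGraphSombor.
Variables (R : realType) (A : finComNzRingType) (half : A).
Hypothesis half2 : 2%:R * half = 1.
Let zd := @zero_divisor A.
Let z := zd_nb A.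
Let b := zd_unit_sum_nb A.

Lemma card_zd_translate (x : A) : #|[set y | zd (x + y)]| = z.
Proof.
rewrite /z /zd_nb -(card_preimset _ (addrI x)).
by apply: eq_card => y; rewrite !inE.
Qed.

(** Translation by [x] gives [z] candidates [y]; the loop [y = x] is among them exactly when
    [x + x], equivalently [x], is a zero-divisor. *)
Lemma degree_total_graph (x : total_graph A) : degree x = (z - zd x)%N.
Proof.
rewrite -(card_zd_translate x) (cardsD1 x [set _ | _]) inE.
rewrite /zd (zero_divisor_double _ half2) addKn.
by apply: eq_card => y; rewrite !inE eq_sym.
Qed.

Lemma card_mixed_adj :
  #|[set u : A * A | [&& zd u.1, ~~ zd u.2 & zd (u.1 + u.2)]]| = b.
Proof.
pose f (u : A * A) := (- u.1, u.1 + u.2).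
have fK : involutive f by case=> x y; rewrite /f /= opprK addKr.
rewrite -(card_preimset _ (inv_inj fK)); apply: eq_card => -[x y].
by rewrite !inE /= /zd addKr zero_divisorN; congr (_ && _); rewrite andbC.
Qed.

Let adjA := @total_adj A.

(** Ensures that the subtraction [z - zd x] is not truncated, so that it carries over to [R]. *)
Lemma zd_nb_gt0 : (0 < z)%N.
Proof.
apply/card_gt0P; exists 0; rewrite inE; apply/existsP; exists 1.
by rewrite mul0r eqxx oner_eq0.
Qed.

Lemma degree_total_graphR (x : total_graph A) :
  (degree x)%:R = z%:R - (zd x)%:R :> R.
Proof. by rewrite degree_total_graph natrB // (leq_trans (leq_b1 _) zd_nb_gt0). Qed.

Lemma card_adj_from_zd :
  #|[set u : A * A | zd u.1 & adjA u.1 u.2]|%:R = z%:R * (z%:R - 1) :> R.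
Proof.
rewrite -sum1dep_card -(pair_big_dep zd adjA (fun _ _ => 1%N)) natr_sum.
rewrite (eq_bigr (fun=> z%:R - 1)) => [|x zdx]; last first.
  by rewrite sum1_card (degree_total_graphR x) zdx.
by rewrite sumr_const [in RHS]mulr_natl /z /zd_nb cardsE.
Qed.

Lemma card_adj_from_nzd :
  #|[set u : A * A | ~~ zd u.1 & adjA u.1 u.2]|%:R
  = (#|A|%:R - z%:R) * z%:R :> R.
Proof.
rewrite -sum1dep_card.
rewrite -(pair_big_dep (fun x => ~~ zd x) adjA (fun _ _ => 1%N)) natr_sum.
rewrite (eq_bigr (fun=> z%:R)) => [|x zdx]; last first.
  by rewrite sum1_card (degree_total_graphR x) (negPf zdx) subr0.
have card_zd : #|zd| = z by rewrite /z /zd_nb cardsE.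
by rewrite sumr_const -(cardC zd) card_zd natrD (addrC z%:R) addrK [in RHS]mulr_natl.
Qed.

Lemma card_edges_total_graph :
  #|edges (total_graph A)|%:R *+ 2 = z%:R * (#|A|%:R - 1) :> R.
Proof.
rewrite -sum1_card natr_sum -sum_adj_edges pair_big_dep (bigID (fun u => zd u.1)) /=.
rewrite !sumr_const.
transitivity (z%:R * (z%:R - 1) + (#|A|%:R - z%:R) * z%:R : R); last by ring.
rewrite -card_adj_from_zd -card_adj_from_nzd.
by congr (_%:R + _%:R); apply: eq_card => u; rewrite !inE andbC.
Qed.

Lemma Sombor_total_graph :
  Sombor R (total_graph A) *+ 2 =
    Num.sqrt 2 * (z%:R * (z%:R - 1) - b%:R) * (z%:R - 1)
    + 2 * b%:R * Num.sqrt ((z%:R - 1) ^+ 2 + z%:R ^+ 2)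
    + Num.sqrt 2 * ((#|A|%:R - z%:R) * z%:R - b%:R) * z%:R.
Proof.
pose c (s t : bool) : R := Num.sqrt ((z%:R - s%:R) ^+ 2 + (z%:R - t%:R) ^+ 2).
have sqrt_diag (s : bool) : c s s = Num.sqrt 2 * (z%:R - s%:R).
  rewrite /c -mulr2n -[X in Num.sqrt X = _]mulr_natl sqrtrM // sqrtr_sqr
    ger0_norm // subr_ge0 ler_nat.
  by rewrite (leq_trans (leq_b1 _) zd_nb_gt0).
(* Ordered adjacent pairs are sorted by the status of both ends; the weight is the constant [c s t]
   on [S s t]. *)
pose S (s t : bool) : {set A * A} :=
  [set u | [&& zd u.1 == s, zd u.2 == t & adjA u.1 u.2]].
have cardS s : (#|S s (~~ s)| = b)%N.
  have card_tf : (#|S true false| = b)%N.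
    rewrite -card_mixed_adj; apply: eq_card => -[x y]; rewrite !inE /= eqb_id eqbF_neg.
    case: (boolP (zd x)) => //= zdx; case: (boolP (zd y)) => //= nzdy.
    (* The clause [x != y] of adjacency is automatic when only one of the two is a zero-divisor. *)
    by rewrite /adjA /total_adj; case: eqVneq nzdy => // <-; rewrite zdx.
  have swapK : involutive (fun u : A * A => (u.2, u.1)) by case.
  case: s => //; rewrite -card_tf -(card_preimset _ (inv_inj swapK)).
  apply: eq_card => -[x y]; rewrite !inE /= [adjA y x]total_adj_sym.
  by case: (zd x); case: (zd y).
(* The diagonal classes are counted by complement among the pairs whose first end has status [s]. *)
have cardSD s : (#|S s s| + b = #|[set u | (zd u.1 == s) && adjA u.1 u.2]|)%N.
  rewrite -(cardS s) -cardsUI [X in (_ + X)%N](_ : _ = 0%N) ?addn0.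
    by apply: eq_card => u; rewrite !inE;
      case: s (zd u.1) (zd u.2) (adjA _ _) => [] [] [] [].
  by apply/eqP; rewrite cards_eq0; apply/eqP/setP => u; rewrite !inE;
    case: s (zd u.1) (zd u.2) (adjA _ _) => [] [] [] [].
have sumS s t : \sum_(u in S s t) c (zd u.1) (zd u.2) = #|S s t|%:R * c s t.
  rewrite mulr_natl -sumr_const; apply: eq_bigr => u.
  by rewrite inE => /and3P[/eqP-> /eqP->].
transitivity (\sum_(u | adjA u.1 u.2) c (zd u.1) (zd u.2)).
  rewrite /Sombor -sum_adj_edges pair_big_dep; apply: eq_bigr => -[x y] /= /andP[neq_xy _].
  by rewrite big_setU1 ?inE //= big_set1 !degree_total_graphR.
transitivity (\sum_s \sum_t \sum_(u in S s t) c (zd u.1) (zd u.2)).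
  rewrite (partition_big (fun u => zd u.1) predT) //; apply: eq_bigr => s _.
  rewrite (partition_big (fun u => zd u.2) predT) //; apply: eq_bigr => t _.
  by apply: eq_bigl => u; rewrite !inE andbC andbCA andbA andbC -!andbA; do !bool_congr.
have cardSDR s : #|S s s|%:R = #|[set u | (zd u.1 == s) && adjA u.1 u.2]|%:R - b%:R :> R.
  by rewrite -cardSD natrD addrK.
rewrite !big_bool /= !sumS !sqrt_diag !cardSDR (cardS true) (cardS false).
rewrite [X in X%:R - _](_ : _ = #|[set u : A * A | zd u.1 & adjA u.1 u.2]|); last first.
  by apply: eq_card => u; rewrite !inE eqb_id.
rewrite [in X in _ + X](_ : #|_| = #|[set u : A * A | ~~ zd u.1 & adjA u.1 u.2]|); last first.
  by apply: eq_card => u; rewrite !inE eqbF_neg.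
have cC : c false true = c true false by rewrite /c addrC.
by rewrite card_adj_from_zd card_adj_from_nzd cC /c subr0 /=; ring.
Qed.

End TotalGraphSombor.

(** * Divisibility and zero-divisors in Z/n *)

Section Zn.
Variable n : nat.
Hypothesis n_gt1 : (1 < n)%N.

Let ZnE : (Zp_trunc n).+2 = n := Zp_cast n_gt1.

Lemma big_Zn (V : nmodType) (P : pred nat) (F : nat -> V) :
  \sum_(x : 'Z_n | P x) F x = \sum_(0 <= i < n | P i) F i.
Proof. by rewrite -[in RHS]ZnE big_mkord. Qed.

Lemma card_Zn_dvdn (d : nat) : (d %| n)%N ->
  #|[set x : 'Z_n | (d %| x)%N]| = (n %/ d)%N.
Proof.
move=> dn; have n_gt0 := ltnW n_gt1.
rewrite -sum1dep_card (big_Zn (fun i => d %| i)%N (fun=> 1%N)) divn_count_dvd.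
(* [divn_count_dvd] counts over 1..n, the ring over 0..n-1; the differing terms n and 0 are both
   multiples of [d]. *)
rewrite big_mkcond [RHS]big_nat_recr //= dn [LHS]big_ltn // dvdn0 [RHS]addnC /=.
by congr (_ + _)%N; apply: eq_bigr => i _; case: (d %| i)%N.
Qed.

Lemma dvdn_ZnD (d : nat) (x y : 'Z_n) : (d %| n)%N ->
  (d %| (x + y)%R)%N = (d %| x + y)%N.
Proof. by move=> dn; rewrite /= /dvdn modn_dvdm // ZnE. Qed.

Lemma zero_divisor_Zn (x : 'Z_n) : zero_divisor x = ~~ coprime n x.
Proof.
have eqZn0 (y : 'Z_n) : (x * y == 0) = (n %| x * y)%N.
  by rewrite -val_eqE /= /dvdn; congr ((_ %% _)%N == _).
apply/existsP/idP => [[y /andP[y_neq0]]|ncop].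
  rewrite eqZn0; apply: contraTN => cop; rewrite Gauss_dvdr //.
  apply/negP => /dvdn_leq; rewrite lt0n => /(_ y_neq0).
  by rewrite leqNgt -[X in (_ < X)%N]ZnE ltn_ord.
have g_gt0 : (0 < gcdn n x)%N by rewrite gcdn_gt0 ltnW.
have g_gt1 : (1 < gcdn n x)%N.
  by rewrite ltn_neqAle g_gt0 andbT eq_sym.
(* The witness n / gcd(n, x) annihilates [x]; it is a nonzero residue because the gcd exceeds 1. *)
have y_lt : (n %/ gcdn n x < (Zp_trunc n).+2)%N.
  by apply: leq_trans (ltn_Pdiv g_gt1 (ltnW n_gt1)) _; rewrite ZnE.
exists (Ordinal y_lt); rewrite eqZn0 /= -val_eqE /= -lt0n divn_gt0 //.
rewrite dvdn_leq ?dvdn_gcdl 1?ltnW //=.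
by rewrite muln_divA ?dvdn_gcdl // mulnC -muln_divA ?dvdn_gcdr // dvdn_mulr.
Qed.

Lemma zd_nb_Zn : zd_nb 'Z_n = (n - totient n)%N.
Proof.
rewrite /zd_nb; set Z := [set _ | _].
rewrite -[X in (X - _)%N]ZnE -[X in (X - _)%N]card_ord -(cardsC Z).
suff -> : totient n = #|~: Z| by rewrite addnK.
rewrite totient_count_coprime -sum1_card.
rewrite (eq_bigl (fun x : 'Z_n => coprime n x)) => [|x].
  rewrite (big_Zn (coprime n) (fun=> 1%N)) [RHS]big_mkcond.
  by apply: eq_bigr => i _; case: coprime.
by rewrite !inE zero_divisor_Zn negbK.
Qed.

Lemma half_Zn : odd n -> 2%:R * (n.+1./2)%:R = 1 :> 'Z_n.
Proof.
move=> n_odd; rewrite -natrM mul2n halfK /= n_odd subn0 -natr1.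
by rewrite pchar_Zp // add0r.
Qed.

End Zn.

(** * Counting in Z/p^2q *)

Section P2Q.
Variables p q : nat.
Hypotheses (p_prime : prime p) (q_prime : prime q) (neq_pq : p != q).
Let n := (p ^ 2 * q)%N.
Let p_gt0 : (0 < p)%N := prime_gt0 p_prime.
Let q_gt0 : (0 < q)%N := prime_gt0 q_prime.

Lemma p2q_gt1 : (1 < n)%N.
Proof. by rewrite /n; have := prime_gt1 p_prime; nia. Qed.
Let n_gt1 := p2q_gt1.

Lemma dvdn_p_p2q : (p %| n)%N. Proof. by rewrite /n expnS -mulnA dvdn_mulr. Qed.
Lemma dvdn_q_p2q : (q %| n)%N. Proof. by rewrite /n dvdn_mull. Qed.

Lemma zero_divisor_p2q (x : 'Z_n) : zero_divisor x = (p %| x)%N || (q %| x)%N.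
Proof.
rewrite zero_divisor_Zn // coprimeMl coprime_pexpl // !prime_coprime //.
by rewrite negb_and !negbK.
Qed.

Lemma totient_p2q : totient n = (p * (p - 1) * (q - 1))%N.
Proof.
rewrite totient_coprime ?coprime_pexpl ?prime_coprime ?dvdn_prime2 //.
by rewrite totient_pfactor // totient_prime // !subn1 expn1 [(p.-1 * p)%N]mulnC.
Qed.

Lemma zd_nb_p2q : zd_nb 'Z_n = (p * (p + q - 1))%N.
Proof.
rewrite zd_nb_Zn // totient_p2q /n.
case: p p_gt0 => // p' _; case: q q_gt0 => // q' _; rewrite !subn1 addnS /=.
rewrite (_ : _ ^ 2 * _ = p'.+1 * (p'.+1 + q') + p'.+1 * p' * q')%N ; last first.
  by rewrite -mulnn; clear; lia.
by rewrite addnK.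
Qed.

Lemma zd_unit_sum_nb_p2q :
  zd_unit_sum_nb 'Z_n = (2 * (p * (q - 1)) * (p * (p - 1)))%N.
Proof.
have nE : n = (p * (p * q))%N by rewrite /n expnS expn1 mulnA.
pose D d := [set x : 'Z_n | (d %| x)%N].
have cardDD : #|D p :&: D q| = p.
  rewrite (_ : _ :&: _ = D (p * q)%N).
    have pq_gt0 : (0 < p * q)%N by rewrite muln_gt0 p_gt0.
    have pq_n : (p * q %| n)%N by rewrite nE dvdn_mull.
    by rewrite card_Zn_dvdn // nE mulnK.
  by apply/setP => x; rewrite !inE Gauss_dvd // prime_coprime // dvdn_prime2.
have cardPQ : #|D p :\: D q| = (p * (q - 1))%N.
  rewrite cardsD cardDD card_Zn_dvdn ?dvdn_p_p2q //.
  by rewrite nE mulKn // mulnBr muln1.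
have cardQP : #|D q :\: D p| = (p * (p - 1))%N.
  rewrite cardsD setIC cardDD card_Zn_dvdn ?dvdn_q_p2q //.
  by rewrite /n mulnK // expnS expn1 mulnBr muln1.
(* The factor 2 becomes a disjoint union of two products of sets, according to which component is
   the multiple of [p]. *)
rewrite -mulnA mul2n -addnn -cardPQ -cardQP -{1}cardsX mulnC -cardsX -cardsUI.
rewrite [X in (_ + X)%N](_ : _ = 0%N) ?addn0; last first.
  apply/eqP; rewrite cards_eq0; apply/eqP/setP => -[x y]; rewrite !inE /=.
  by case: (p %| x)%N; case: (q %| x)%N; rewrite /= ?andbF.
apply: eq_card => -[x y]; rewrite !inE /= !zero_divisor_p2q.
rewrite !dvdn_ZnD ?dvdn_p_p2q ?dvdn_q_p2q //.
(* If [d] divides neither [x] nor [y], this says nothing; but then, for zero-divisors, the other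
   prime divides both and hence their sum. *)
have dvdD d : (d %| x)%N || (d %| y)%N ->
    (d %| x + y)%N = (d %| x)%N && (d %| y)%N.
  have [dx _|ndx dy] /= := boolP (d %| x)%N; first by rewrite dvdn_addr.
  by rewrite dvdn_addl // (negPf ndx).
move: (dvdD p) (dvdD q).
case: (p %| x)%N (p %| y)%N (q %| x)%N (q %| y)%N => [] [] [] [] //=;
  by do ?[move=> /(_ isT)->|move=> _]; rewrite ?orbT.
Qed.

End P2Q.

Theorem theorem3p3 (R : realType) (p q : nat)
  (p_prime : prime p) (q_prime : prime q)
  (p_odd : odd p) (q_odd : odd q) (lt_pq : (p < q)%N) :
  let n := (p ^ 2 * q)%N in
  let G := total_graph 'Z_n in
  let P : R := p%:R in
  let Q : R := q%:R in
  let N : R := n%:R in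
  let phi : R := (totient n)%:R in
  let alpha : R :=
    P * (Q - 1) * (P * (Q - 1) - 1) / 2 + P * (P - 1) * (P * (P - 1) - 1) / 2
    + P * (P - 1) / 2 + P ^+ 2 * (Q - 1) + P ^+ 2 * (P - 1) in
  let beta : R := 2 * P ^+ 2 * (P - 1) * (Q - 1) in
  let E : R := #|edges G|%:R in
  E = P * (P + Q - 1) * (P ^+ 2 * Q - 1) / 2 /\
  Sombor R G =
    Num.sqrt 2 * alpha * (N - phi - 1)
    + beta * Num.sqrt ((N - phi - 1) ^+ 2 + (N - phi) ^+ 2)
    + Num.sqrt 2 * (E - alpha - beta) * (N - phi).
Proof.
move=> n G P Q N phi alpha beta E.
have neq_pq : p != q by rewrite ltn_eqF.
have p_gt0 := prime_gt0 p_prime; have q_gt0 := prime_gt0 q_prime.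
have n_gt1 : (1 < n)%N by apply: p2q_gt1.
have n_odd : odd n by rewrite oddM oddX p_odd.
have half2 := half_Zn n_gt1 n_odd.
have cardZn : #|'Z_n| = n by rewrite card_ord Zp_cast.
have NE : N = P ^+ 2 * Q by rewrite /N natrM natrX.
have zE : (zd_nb 'Z_n)%:R = P * (P + Q - 1).
  by rewrite zd_nb_p2q // natrM natrB ?natrD // addn_gt0 p_gt0.
have phiE : phi = P * (P - 1) * (Q - 1).
  by rewrite /phi totient_p2q // !natrM !natrB.
have bE : (zd_unit_sum_nb 'Z_n)%:R = beta.
  by rewrite zd_unit_sum_nb_p2q // !natrM !natrB // /beta; ring.
(* This identifies the two degrees in the formula, N - phi - 1 and N - phi, as z - 1 and z. *)
have NphiE : N - phi = (zd_nb 'Z_n)%:R by rewrite zE NE phiE; ring.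
have two_neq0 : (2 : R) != 0 by rewrite pnatr_eq0.
have EE : E = P * (P + Q - 1) * (P ^+ 2 * Q - 1) / 2.
  apply: (mulIf two_neq0); rewrite divfK // mulr_natr.
  by rewrite (card_edges_total_graph R half2) cardZn zE -/N NE.
split=> //; apply: (mulIf two_neq0); rewrite mulr_natr.
rewrite (Sombor_total_graph R half2) cardZn bE NphiE -/N.
(* With both roots abstracted, what remains is a rational identity in [P], [Q], [s] and [s2]. *)
set s := Num.sqrt (_ ^+ 2 + _ ^+ 2); set s2 := Num.sqrt 2.
by rewrite EE zE NE /alpha /beta; field.
Qed.
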